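(* For any integers $k>l\ge 2$, as $n\to\infty$, $$ex(n,C_{2l+1},\{C_3,C_4,\dots,C_{2l}\}\cup\{C_{2k+1}\})=\Omega(n^{1+\frac{1}{2k+2}})\quad\text{and}\quad ex(n,C_{2l+1},\{C_3,C_4,\dots,C_{2l}\}\cup\{C_{2k+1}\})=O(n^{2}).$$
   Context: $C_k$ denotes the cycle with $k$ vertices. For a graph $H$ and a family of graphs $\mathcal F$, $ex(n,H,\mathcal F)$ is the maximum number of subgraphs isomorphic to $H$ in an $n$-vertex graph containing no member of $\mathcal F$ as a subgraph. *)

(* Defs.v *)
From Stdlib Require Import Reals.
From mathcomp Require Import all_boot.
Set Implicit Arguments. Unset Strict Implicit. Unset Printing Implicit Defensive.

Definition simple_graph (n : nat) (E : {set {set 'I_n}}) : bool :=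
  [forall e in E, #|e| == 2].

Definition cycle_edges (n k : nat) (F : {set {set 'I_n}}) : bool :=
  [exists f : {ffun 'I_k -> 'I_n},
     injectiveb f &&
     (F == [set [set f i; f (insubd i ((i.+1) %% k))] | i : 'I_k])].

(* Number of subgraphs of E isomorphic to C_k (for k >= 3). *)
Definition num_cycles (n k : nat) (E : {set {set 'I_n}}) : nat :=
  #|[set F : {set {set 'I_n}} | (F \subset E) && cycle_edges k F]|.

Definition has_cycle (n k : nat) (E : {set {set 'I_n}}) : bool :=
  [exists F : {set {set 'I_n}}, (F \subset E) && cycle_edges k F].

Definition forbidden (l k j : nat) : bool :=
  ((3 <= j) && (j <= 2 * l)) || (j == (2 * k).+1).

(* E contains no member of the forbidden family (only j <= 2k+1 matter). *)
Definition family_free (n l k : nat) (E : {set {set 'I_n}}) : bool :=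
  [forall j : 'I_(2 * k).+2, forbidden l k j ==> ~~ has_cycle j E].

Definition ex_cycles (l k n : nat) : nat :=
  \max_(E : {set {set 'I_n}} | simple_graph E && family_free l k E)
     num_cycles (2 * l).+1 E.

(* Main.v *)
(** Upper bound.  All cycles of length at most 2l being excluded, two vertices
are joined by at most one path of length at most l, so a C_(2l+1) through v is
determined by v and the edge opposite to v, which joins two vertices of the
sphere L_v of ends of paths of length l from v.  A vertex of L_v has at most one
neighbour in each branch at v.  If some subgraph of L_v had minimum degree above
2k+1, a greedy path of length 2(k-l)+1 inside it could be made to end in another
branch than it started in, and the two paths back to v would close it into a
C_(2k+1).  Hence L_v spans O(n) edges.

Lower bound.  Take a graph with the most edges among the family-free unions of
C_(2l+1)'s of maximum degree at most D.  Attaching a new C_(2l+1) to 2l+1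
vertices of low degree at pairwise distance more than 2k creates no other cycle
of length at most 2k+1, since such a cycle would contain an old path between two
of these vertices.  So the low-degree vertices lie in fewer than 2l+1 balls of
radius 2k, i.e. there are at most (2l+1)(D+1)^(2k) <= n/2 of them when D is about
n^(1/2k), and the graph has order n D edges, so order n D copies of C_(2l+1). *)
Require Import Defs.
From mathcomp Require Import all_boot.
From mathcomp Require Import zify.
Set Implicit Arguments. Unset Strict Implicit. Unset Printing Implicit Defensive.

(** * Cycles of a graph as cyclic sequences of vertices *)

Definition adj (n : nat) (E : {set {set 'I_n}}) : rel 'I_n :=
  fun x y => [set x; y] \in E.

Definition cycle_edge_set (n : nat) (c : seq 'I_n) : {set {set 'I_n}} :=
  [set [set x; next c x] | x in c].

Lemma adj_sym n (E : {set {set 'I_n}}) : symmetric (adj E).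
Proof. by move=> x y; rewrite /adj setUC. Qed.

Lemma adj_irr n (E : {set {set 'I_n}}) : simple_graph E -> irreflexive (adj E).
Proof.
move=> /forall_inP sE x; apply/negP=> /sE.
by rewrite setUid cards1.
Qed.

Lemma set2_eq (T : finType) (x y u v : T) :
  [set x; y] = [set u; v] -> (x = u /\ y = v) \/ (x = v /\ y = u).
Proof.
move=> e.
have : x \in [set u; v] by rewrite -e set21.
have : y \in [set u; v] by rewrite -e set22.
have : u \in [set x; y] by rewrite e set21.
have : v \in [set x; y] by rewrite e set22.
rewrite !in_set2.
by do 4 (case/orP=> /eqP ?); subst; auto.
Qed.

Lemma next_nth_mod (T : eqType) (x0 : T) (c : seq T) i :
  uniq c -> i < size c -> next c (nth x0 c i) = nth x0 c (i.+1 %% size c).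
Proof.
move=> uc ic; rewrite next_nth mem_nth // index_uniq //.
case: c uc ic => [|y c] //= _; rewrite ltnS leq_eqVlt => /orP[/eqP->|ic].
  by rewrite modnn nth_default.
by rewrite modn_small //= (set_nth_default x0).
Qed.

Lemma cycle_edgesP n j (F : {set {set 'I_n}}) : 0 < j ->
  reflect (exists c, [/\ uniq c, size c = j & F = cycle_edge_set c])
          (cycle_edges j F).
Proof.
move=> j0; apply: (iffP existsP) => [[f /andP[/injectiveP fi /eqP->]]|[c [uc sc ->]]].
  exists (map f (enum 'I_j)).
  have uc : uniq (map f (enum 'I_j)) by rewrite map_inj_uniq // enum_uniq.
  have sc : size (map f (enum 'I_j)) = j by rewrite size_map size_enum_ord.
  (* The index is reduced mod [j], so the default value of [insubd] is never taken. *)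
  have nx i : next (map f (enum 'I_j)) (f i) = f (insubd i (i.+1 %% j)).
    have -> : f i = nth (f i) (map f (enum 'I_j)) i.
      by rewrite (nth_map i) ?size_enum_ord // nth_ord_enum.
    rewrite next_nth_mod ?sc // (nth_map i) ?size_enum_ord ?ltn_pmod //.
    congr (f _); apply: val_inj; rewrite val_insubd ltn_pmod //=.
    by rewrite nth_enum_ord // ltn_pmod.
  split=> //; apply/setP=> e; apply/imsetP/imsetP => [[i _ ->]|[x]].
    by exists (f i); rewrite ?nx // map_f // mem_enum.
  by case/mapP=> i _ -> ->; exists i; rewrite ?nx.
have x0 : 'I_n by case: c sc {uc} => [/esym/eqP|//]; rewrite eqn0Ngt j0.
exists [ffun i : 'I_j => nth x0 c i]; apply/andP; split.
  apply/injectiveP=> a b; rewrite !ffunE => /eqP.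
  by rewrite nth_uniq ?sc // => /eqP/val_inj.
have nx (i : 'I_j) : nth x0 c (insubd i (i.+1 %% j)) = next c (nth x0 c i).
  by rewrite next_nth_mod ?sc // val_insubd ltn_pmod.
apply/eqP/setP=> e; apply/imsetP/imsetP => [[x xc ->]|[i _ ->]].
  have ix : index x c < j by rewrite -sc index_mem.
  by exists (Ordinal ix) => //; rewrite !ffunE nx /= nth_index.
by exists (nth x0 c i); rewrite ?ffunE ?nx // mem_nth ?sc.
Qed.

Lemma cycle_edge_set_sub n (E : {set {set 'I_n}}) c :
  uniq c -> (cycle_edge_set c \subset E) = cycle (adj E) c.
Proof.
move=> uc; apply/subsetP/idP => [cE|cc e /imsetP[x xc ->]].
  by apply: cycle_from_next => // x xc; apply: cE; apply: imset_f.
exact: (next_cycle cc xc).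
Qed.

Lemma has_cycleP n j (E : {set {set 'I_n}}) : 0 < j ->
  reflect (exists c, [/\ uniq c, size c = j & cycle (adj E) c])
          (has_cycle j E).
Proof.
move=> j0; apply: (iffP existsP) => [[F /andP[FE /(cycle_edgesP _ j0)[c [uc sc eF]]]]|[c [uc sc cc]]].
  by exists c; rewrite -cycle_edge_set_sub // -eF.
exists (cycle_edge_set c); rewrite cycle_edge_set_sub // cc /=.
by apply/cycle_edgesP => //; exists c.
Qed.

Lemma family_freeP n l k (E : {set {set 'I_n}}) :
  reflect (forall c, uniq c -> cycle (adj E) c -> size c <= (2 * k).+1 ->
             ~~ forbidden l k (size c))
          (family_free l k E).
Proof.
apply: (iffP forallP) => [h c uc cc sc|h j].
  apply/negP=> fc; have := h (Ordinal (sc : size c < (2 * k).+2)).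
  rewrite /= fc /= => /negP[]; apply/has_cycleP; last by exists c.
  by move: fc; rewrite /forbidden => /orP[/andP[]|/eqP->] //; case: (size c).
apply/implyP=> fj; apply/negP; case/has_cycleP.
  by move: fj; rewrite /forbidden => /orP[/andP[]|/eqP->] //; case: (val j).
move=> c [uc sc cc]; have := h c uc cc; rewrite sc fj -ltnS ltn_ord.
by move/(_ isT).
Qed.

(** * Short paths, spheres and branches under a girth condition *)

Section ShortPaths.
Variables (T : finType) (e : rel T) (g : nat).
Hypotheses (e_sym : symmetric e) (e_irr : irreflexive e).
(** An edge traversed back and forth satisfies [uniq] and [cycle e]; the condition [2 < size c] sets
    such degenerate cycles aside. *)
Hypothesis girth : forall c, uniq c -> cycle e c -> 2 < size c -> g < size c.

(** Once their common start is removed, different paths leave [x] by different vertices. Cut at the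
    first vertex of [p] lying on [q], they close into a cycle of length at most [size p + size q],
    which the girth forbids. *)
Lemma short_path_unique x p q :
  path e x p -> path e x q -> uniq (x :: p) -> uniq (x :: q) ->
  last x p = last x q -> size p + size q <= g -> p = q.
Proof.
elim: p x q => [|y p IHp] x [|z q] //=.
- by move=> _ _ _ /andP[xq _] lx; rewrite lx mem_last in xq.
- by move=> _ _ /andP[xp _] _ lx; rewrite -lx mem_last in xp.
move=> /andP[exy pp] /andP[exz pq] /andP[xp up] /andP[xq uq] lpq szg.
have [yz|yz] := eqVneq y z.
  subst z; congr (_ :: _); by apply: (IHp y) => //; move: szg; rewrite addSn addnS => /ltnW/ltnW.
have hw : has (mem (z :: q)) (y :: p).
  by apply/hasP; exists (last y p); rewrite ?mem_last //= lpq mem_last.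
have pyp : path e x (y :: p) by rewrite /= exy.
have pzq : path e x (z :: q) by rewrite /= exz.
have szg' : size (y :: p) + size (z :: q) <= g by [].
(* Only the heads [y] and [z] of the two paths are remembered, so that the paths can be split at
   their meeting vertex [w]. *)
have [p' p'E] : exists p', p' = y :: p by exists (y :: p).
have [q' q'E] : exists q', q' = z :: q by exists (z :: q).
have hy : head x p' = y by rewrite p'E.
have hz : head x q' = z by rewrite q'E.
rewrite -cons_uniq -p'E in up; rewrite -cons_uniq -q'E in uq.
rewrite -p'E -q'E in hw xp pyp szg' xq pzq.
clear p'E q'E.
case/split_find: hw xp up pyp szg' hy => w p1 p2 wq hp1 xp up pyp szg' hy.
move: wq; rewrite inE => wq.
case/splitPr: wq xq uq pzq hz hp1 szg' => q1 q2 xq uq pzq hz hp1 szg'.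
pose c := x :: rcons p1 w ++ rev q1.
have uc : uniq c.
  rewrite /c /= mem_cat mem_rev negb_or.
  move: xp; rewrite mem_cat negb_or => /andP[-> _].
  move: xq; rewrite mem_cat negb_or => /andP[-> _] /=.
  rewrite cat_uniq rev_uniq; move: up; rewrite cat_uniq => /andP[-> _] /=.
  move: uq; rewrite cat_uniq /= => /and3P[-> /norP[wq1 _] _].
  rewrite andbT; apply/hasPn => t; rewrite mem_rev => tq1; rewrite mem_rcons inE.
  apply/norP; split; first by apply: contraNneq wq1 => <-.
  apply: contraNN hp1 => tp1; apply/hasP; exists t => //.
  by rewrite inE mem_cat tq1.
have cc : cycle e c.
  rewrite /c /= rcons_cat cat_path last_rcons.
  move: pyp; rewrite cat_path => /andP[-> _] /=.
  move: pzq; rewrite -cat_rcons cat_path => /andP[pq1 _].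
  have := rev_path e x (rcons q1 w).
  rewrite last_rcons belast_rcons rev_cons => ->.
  by rewrite (eq_path (e' := e)) // => a b; apply: e_sym.
have := girth uc cc; rewrite /c /= size_cat size_rcons size_rev.
move: szg'; rewrite !size_cat size_rcons /= -addn1 => sz1 sz2.
suff h : 0 < size p1 + size q1.
  have /sz2 : 2 < (size p1 + 1 + size q1).+1 by rewrite addnAC addn1.
  clear -sz1; lia.
(* If both pieces were empty, [w] would be the second vertex of both paths, against [y != z]. *)
case: p1 hy {hp1 uc cc c xp up pyp sz1 sz2} => [|? ?] //= hy.
case: q1 hz {uq xq pzq} => //= hz.
by rewrite -hy -hz eqxx in yz.
Qed.

Definition is_path_to v l x (p : seq T) :=
  [&& size p == l, path e v p, uniq (v :: p) & last v p == x].

(** When [l + l <= g], uniqueness of short paths makes this the set of vertices at distance exactly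
    [l] from [v]. *)
Definition sphere v l : {set T} :=
  [set x | [exists p : l.-tuple T, is_path_to v l x p]].

Definition path_to v l x : seq T :=
  if [pick p : l.-tuple T | is_path_to v l x p] is Some p then p else [::].

Lemma path_toP v l x : x \in sphere v l -> is_path_to v l x (path_to v l x).
Proof.
rewrite inE /path_to; case: pickP => [p //|np] /existsP[p].
by rewrite np.
Qed.

Lemma is_path_to_sphere v l x p : is_path_to v l x p -> x \in sphere v l.
Proof.
move=> h; rewrite inE; apply/existsP; have /andP[sp _] := h.
by exists (Tuple sp).
Qed.

Lemma is_path_to_inj v a b x p q : is_path_to v a x p -> is_path_to v b x q ->
  a + b <= g -> p = q.
Proof.
move=> /and4P[/eqP <- pp up /eqP lp] /and4P[/eqP <- pq uq /eqP lq] h.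
by apply: (short_path_unique pp pq up uq) => //; rewrite lp lq.
Qed.

Lemma is_path_to_take v l x p w : is_path_to v l x p -> w \in p ->
  exists2 a, is_path_to v (size a) w a & exists b, p = a ++ b /\ last w b = x.
Proof.
move=> /and4P[_ pp up /eqP lp] wp; case/path.splitP: wp pp up lp => p1 p2 pp up lp.
exists (rcons p1 w); last by exists p2; move: lp; rewrite last_cat last_rcons.
rewrite /is_path_to eqxx last_rcons eqxx andbT /=.
move: pp; rewrite cat_path => /andP[-> _] /=.
by move: up; rewrite /= mem_cat negb_or cat_uniq => /andP[/andP[-> _] /andP[-> _]].
Qed.

(** The part of [p] up to [w] is a path of length at most [l], so by uniqueness it is the path of
    length [l] that puts [w] on the sphere; nothing of [p] is left after it. *)
Lemma mem_path_to_sphere v l x p w : l + l <= g ->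
  is_path_to v l x p -> w \in p -> w \in sphere v l -> w = x.
Proof.
move=> lg hp wp /path_toP hw; case: (is_path_to_take hp wp) => a ha [b [pab lb]].
have sp : size p = l by case/andP: hp => /eqP.
have sa : size a <= l by rewrite -sp pab size_cat leq_addr.
have aE := is_path_to_inj ha hw (leq_trans (leq_add sa (leqnn l)) lg).
have : size a = l by rewrite aE; case/andP: hw => /eqP.
move: sp; rewrite pab size_cat => sp1 sp2.
have /size0nil b0 : size b = 0 by clear -sp1 sp2; lia.
by rewrite b0 in lb.
Qed.

Lemma source_notin_sphere v l : 0 < l -> v \notin sphere v l.
Proof.
move=> l0; apply/negP => /path_toP /and4P[/eqP sp _ up /eqP lp].
move: up; rewrite /= -{1}lp; case: (path_to v l v) sp => [|a s] /= sp.
  by move: l0; rewrite -sp.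
by rewrite mem_last.
Qed.

(** The branch of a path from [v] is recorded by its first step, [head v p]. Up to a common vertex
    [w] the two paths coincide by uniqueness, and this part is not empty because [w] differs from
    [v]. *)
Lemma branch_disjoint v l x y p q w : l + l <= g ->
  is_path_to v l x p -> is_path_to v l y q -> w \in p -> w \in q ->
  head v p = head v q.
Proof.
move=> lg hp hq wp wq.
case: (is_path_to_take hp wp) => a ha [b [pab _]].
case: (is_path_to_take hq wq) => a' ha' [b' [qab _]].
have sp : size p = l by case/andP: hp => /eqP.
have sq : size q = l by case/andP: hq => /eqP.
have aE : a = a'.
  by apply: (is_path_to_inj ha ha'); move: sp sq; rewrite pab qab !size_cat; lia.
subst a'; rewrite pab qab; case: a ha {pab qab ha'} => // /and4P[_ _ _ /eqP /= vw].
move: hp => /and4P[_ _ /andP[vp _] _]; by rewrite vw wp in vp.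
Qed.

(** If both paths began with the same neighbour [b] of [v], extending them to [z] would give two
    paths of length [l] from [b] to [z], equal by uniqueness, whence [x = y]. *)
Lemma branch_neq v l x y z p q : l + l <= g -> 0 < l ->
  is_path_to v l x p -> is_path_to v l y q -> z \in sphere v l ->
  e z x -> e z y -> x != y -> head v p != head v q.
Proof.
move=> lg l0 hp hq hz ezx ezy xy.
case: p hp => [|b p] hp; first by case/andP: hp => /eqP h; rewrite -h in l0.
case: q hq => [|b' q] hq; first by case/andP: hq => /eqP h; rewrite -h in l0.
apply: contraNneq xy => /= bE; subst b'.
have zp : z \notin b :: p.
  apply/negP => /(mem_path_to_sphere lg hp)/(_ hz) zx.
  by rewrite zx e_irr in ezx.
have zq : z \notin b :: q.
  apply/negP => /(mem_path_to_sphere lg hq)/(_ hz) zy.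
  by rewrite zy e_irr in ezy.
move: hp hq => /and4P[/eqP /= sp /andP[_ pp] /andP[_ up] /eqP lp].
move=> /and4P[/eqP /= sq /andP[_ pq] /andP[_ uq] /eqP lq].
have : rcons p z = rcons q z.
  apply: (@short_path_unique b).
  - by rewrite rcons_path pp lp e_sym.
  - by rewrite rcons_path pq lq e_sym.
  - by rewrite -rcons_cons rcons_uniq zp.
  - by rewrite -rcons_cons rcons_uniq zq.
  - by rewrite !last_rcons.
  - rewrite !size_rcons; lia.
by case/rcons_inj => pq'; rewrite -lp -lq pq'.
Qed.

End ShortPaths.

(** * Degree sums of degenerate graphs, and greedy paths *)

Section MinDegree.
Variables (T : finType) (e : rel T).
Hypothesis e_sym : symmetric e.

Definition nbhd (S : {set T}) x : {set T} := [set y in S | e x y].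

(** Deleting a vertex of degree at most [d] lowers the degree sum by at most [2 * d], and the
    hypothesis is inherited by what remains. *)
Lemma sum_degree_le d (S : {set T}) :
  (forall S' : {set T}, S' \subset S -> S' != set0 ->
     exists2 x, x \in S' & #|nbhd S' x| <= d) ->
  \sum_(x in S) #|nbhd S x| <= 2 * d * #|S|.
Proof.
elim: {S}#|S| {-2}S (erefl #|S|) => [|m IHm] S cS hS.
  by rewrite (cards0_eq cS) big_set0.
have [x xS dx] : exists2 x, x \in S & #|nbhd S x| <= d.
  by apply: hS => //; rewrite -card_gt0 cS.
have cSx : #|S :\ x| = m by move: cS; rewrite (cardsD1 x) xS => -[].
have IH : \sum_(y in S :\ x) #|nbhd (S :\ x) y| <= 2 * d * m.
  rewrite -cSx; apply: IHm => // S' sS'; apply: hS.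
  by rewrite (subset_trans sS') // subsetDl.
rewrite (big_setD1 x) //=.
have : \sum_(y in S :\ x) #|nbhd S y|
       <= \sum_(y in S :\ x) (#|nbhd (S :\ x) y| + e x y).
  apply: leq_sum => y _.
  rewrite (cardsD1 x (nbhd S y)) inE xS e_sym addnC leq_add2r /=.
  by apply: subset_leq_card; apply/subsetP=> z; rewrite !inE andbA.
rewrite big_split /=.
have : \sum_(y in S :\ x) e x y <= #|nbhd S x|.
  rewrite -sum1_card big_mkcond [X in _ <= X]big_mkcond /=; apply: leq_sum => y _.
  by rewrite !inE; case: (y \in S); case: (e x y); case: (y != x).
rewrite cS; lia.
Qed.

(** A path with fewer than [m] vertices cannot contain all neighbours of its end, so it can be
    prolonged. *)
Lemma greedy_path (S : {set T}) m x t :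
  (forall y, y \in S -> m <= #|nbhd S y|) -> x \in S -> t < m ->
  exists p, [/\ size p = t, path e x p, uniq (x :: p) & {subset x :: p <= S}].
Proof.
move=> hS xS; elim: t => [|t IHt] tm.
  by exists [::]; split=> // y; rewrite inE => /eqP->.
have [p [sp pp up pS]] := IHt (ltnW tm).
have lS : last x p \in S by apply: pS; apply: mem_last.
have : 0 < #|nbhd S (last x p) :\: [set y in x :: p]|.
  rewrite cardsD subn_gt0; apply: leq_trans (hS _ lS).
  apply: leq_ltn_trans (_ : size (x :: p) < m); last by rewrite /= sp.
  apply: leq_trans (subset_leq_card (subsetIr _ _)) _.
  by rewrite cardsE card_size.
case/card_gt0P=> y; rewrite !inE -in_cons => /and3P[yp yS ey].
exists (rcons p y); rewrite size_rcons sp rcons_path pp ey -rcons_cons rcons_uniq.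
by rewrite yp up; split=> // z; rewrite mem_rcons inE => /orP[/eqP->|/pS].
Qed.

End MinDegree.

(** * Each sphere spans few edges *)

Section SphereSparse.
Variables (T : finType) (e : rel T) (k l : nat) (v : T).
Hypotheses (e_sym : symmetric e) (e_irr : irreflexive e).
Hypothesis girth :
  forall c, uniq c -> cycle e c -> 2 < size c -> 2 * l < size c.
Hypothesis no_long_cycle :
  forall c, uniq c -> cycle e c -> size c != (2 * k).+1.
Hypotheses (l_gt0 : 0 < l) (lk : l < k).

(* Of the two new neighbours of the end of the greedy path, lying in distinct
   branches, one is outside the branch of x. *)
Lemma sphere_path_branch (S : {set T}) x :
  S \subset sphere e v l -> x \in S ->
  (forall y, y \in S -> (2 * k).+1 < #|nbhd e S y|) ->
  exists y r, [/\ size r = 2 * (k - l), path e x (rcons r y),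
    uniq (x :: rcons r y), {subset x :: rcons r y <= S}
    & head v (path_to e v l y) != head v (path_to e v l x)].
Proof.
move=> SL xS hS.
have [|r [sr pr ur rS]] := greedy_path (t := 2 * (k - l)) hS xS.
  by clear; lia.
set z := last x r.
have zS : z \in S by apply: rS; apply: mem_last.
(* [x :: r] has 2(k - l) + 1 <= 2k - 1 vertices, so at least two of the more than 2k + 1 neighbours
   of [z] are new. *)
have : 1 < #|nbhd e S z :\: [set y in x :: r]|.
  rewrite cardsD ltn_subRL; apply: leq_ltn_trans (hS _ zS).
  rewrite addn1 ltnS; apply: (@leq_trans (size (x :: r))).
    apply: leq_trans (subset_leq_card (subsetIr _ _)) _.
    by rewrite cardsE card_size.
  by rewrite /= sr; move: l_gt0 lk; clear; lia.
case/card_gt1P=> y [y' []]; rewrite !inE -!in_cons.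
move=> /and3P[yr yS ezy] /and3P[y'r y'S ezy'] yy'.
have hy := path_toP (subsetP SL _ yS); have hy' := path_toP (subsetP SL _ y'S).
have ll : l + l <= 2 * l by rewrite mul2n addnn.
have br := branch_neq e_sym e_irr girth ll l_gt0 hy hy'
  (subsetP SL _ zS) ezy ezy' yy'.
have ext u : u \notin x :: r -> u \in S -> e z u ->
    [/\ size r = 2 * (k - l), path e x (rcons r u),
    uniq (x :: rcons r u) & {subset x :: rcons r u <= S}].
  move=> ur' uS ezu; rewrite rcons_path pr ezu -rcons_cons rcons_uniq ur' ur.
  by split=> // w; rewrite mem_rcons inE => /orP[/eqP->|/rS].
have [yx|yx] := eqVneq (head v (path_to e v l y)) (head v (path_to e v l x)).
  have [? ? ? ?] := ext y' y'r y'S ezy'; exists y', r; split=> //.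
  by rewrite -yx eq_sym.
by have [? ? ? ?] := ext y yr yS ezy; exists y, r.
Qed.

Lemma is_path_to_last x p : is_path_to e v l x p -> exists q, p = rcons q x.
Proof.
case/lastP: p => [|p w] /and4P[/eqP sp _ _ /eqP].
  by move: l_gt0; rewrite -sp.
by rewrite last_rcons => ->; exists p.
Qed.

Lemma sphere_low_degree (S : {set T}) : S \subset sphere e v l -> S != set0 ->
  exists2 x, x \in S & #|nbhd e S x| <= (2 * k).+1.
Proof.
move=> SL /set0Pn[x xS].
have [/existsP[z /andP[zS dz]]|] :=
  boolP [exists z, (z \in S) && (#|nbhd e S z| <= (2 * k).+1)].
  by exists z.
rewrite negb_exists => /forallP hS; exfalso.
have {}hS y : y \in S -> (2 * k).+1 < #|nbhd e S y|.
  by move=> yS; move: (hS y); rewrite yS -ltnNge.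
have [y [r [sr pr ur rS br]]] := sphere_path_branch SL xS hS.
have yS : y \in S by apply: rS; rewrite -rcons_cons mem_rcons mem_head.
have ll : l + l <= 2 * l by rewrite mul2n addnn.
have hx := path_toP (subsetP SL _ xS); have hy := path_toP (subsetP SL _ yS).
have [qx qxE] := is_path_to_last hx; have [qy qyE] := is_path_to_last hy.
rewrite qxE qyE in br hx hy.
(* Inner vertices of a path to the sphere lie off the sphere, hence off [S]. *)
have off w q u : is_path_to e v l u (rcons q u) -> w \in q -> w \notin S.
  move=> hu wq; apply/negP => /(subsetP SL) wL.
  have := mem_path_to_sphere e_sym girth ll hu _ wL.
  rewrite mem_rcons inE wq orbT => /(_ isT) wu.
  by case/and4P: hu => _ _; rewrite cons_uniq rcons_uniq -wu wq andbF.
have vS : v \notin S.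
  apply/negP=> /(subsetP SL); apply/negP.
  exact: source_notin_sphere.
(* The three pieces have l, 2(k - l) + 2 and l - 1 vertices, 2k + 1 in all. *)
pose c := v :: qx ++ (x :: rcons r y) ++ rev qy.
move: (hx) (hy); rewrite /is_path_to !cons_uniq !rcons_uniq !mem_rcons !inE.
rewrite !negb_or !size_rcons.
move=> /and4P[/eqP sx px /andP[vx ux] _] /and4P[/eqP sy py /andP[vy uy] _].
have uc : uniq c.
  rewrite /c; move: (x :: rcons r y) ur rS => m um mS.
  have vm : v \notin m by apply: contraNN vS => /mS.
  rewrite cons_uniq !mem_cat mem_rev !negb_or vm.
  case/andP: vx => _ ->; case/andP: vy => _ -> /=.
  rewrite !cat_uniq rev_uniq um; case/andP: ux => _ ->; case/andP: uy => _ ->.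
  rewrite has_cat negb_or andbT /=; apply/andP; split.
    apply/andP; split; apply/hasPn => w.
      by move=> /mS; apply: contraTN => /(off _ _ _ hx).
    (* A common vertex of [qx] and [qy] would put [x] and [y] in the same branch. *)
    rewrite mem_rev => wy; apply/negP => /= wx.
    have := branch_disjoint e_sym girth ll hx hy (w := w).
    rewrite !mem_rcons !inE wx wy !orbT => /(_ isT isT) h.
    by rewrite h eqxx in br.
  apply/hasPn => w; rewrite mem_rev => /(off _ _ _ hy).
  by apply: contraNN => /mS.
have cc : cycle e c.
  have -> : cycle e c =
      path e v (rcons qx x ++ rcons r y ++ rcons (rev qy) v).
    by rewrite cat_rcons /c /cycle !rcons_cat.
  rewrite !cat_path !last_rcons px pr /=.
  have := rev_path e v (rcons qy y).
  rewrite last_rcons belast_rcons rev_cons => ->.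
  by rewrite (eq_path (e' := e)) // => a b; apply: e_sym.
have := no_long_cycle uc cc; rewrite /c -cat_cons !size_cat size_rev.
have -> : size (v :: qx) = l by [].
have -> : size (x :: rcons r y) = (2 * (k - l)).+2 by rewrite /= size_rcons sr.
have sum_eq a b : a.+1 = l -> b.+1 = l ->
    l + ((2 * (k - l)).+2 + b) = (2 * k).+1.
  by move: lk; clear; lia.
by move/eqP; apply; apply: sum_eq sx sy.
Qed.

Lemma sphere_sparse :
  \sum_(x in sphere e v l) #|nbhd e (sphere e v l) x|
    <= 2 * (2 * k).+1 * #|sphere e v l|.
Proof. by apply: (sum_degree_le e_sym) => S; apply: sphere_low_degree. Qed.

End SphereSparse.

(** * The quadratic upper bound *)

Lemma num_cycles_le n k l (E : {set {set 'I_n}}) : 0 < l -> l < k ->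
  simple_graph E -> family_free l k E ->
  num_cycles (2 * l).+1 E <= 2 * (2 * k).+1 * n ^ 2.
Proof.
move=> l0 lk sE /family_freeP fE.
have e_sym := adj_sym E; have e_irr := adj_irr sE.
have girth c : uniq c -> cycle (adj E) c -> 2 < size c -> 2 * l < size c.
  move=> uc cc c2; rewrite ltnNge; apply/negP => cl.
  have ck : size c <= (2 * k).+1 by move: cl lk; clear; lia.
  by have := fE c uc cc ck; rewrite /forbidden c2 cl.
have nolong c : uniq c -> cycle (adj E) c -> size c != (2 * k).+1.
  move=> uc cc; apply/eqP => sc; have := fE c uc cc.
  by rewrite sc /forbidden eqxx orbT => /(_ (leqnn _)).
pose P v := path_to (adj E) v l.
pose Phi (t : 'I_n * ('I_n * 'I_n)) :=
  cycle_edge_set (t.1 :: P t.1 t.2.1 ++ rev (P t.1 t.2.2)).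
pose L v := sphere (adj E) v l.
pose Tr := [set t : 'I_n * ('I_n * 'I_n) |
  (t.2.1 \in L t.1) && (t.2.2 \in nbhd (adj E) (L t.1) t.2.1)].
(* A cycle is cut at a vertex [v] into two paths of length [l], whose ends [x] and [y] are joined by
   the opposite edge. By uniqueness these paths are [P v x] and [P v y], so the triple recovers the
   cycle. *)
have sub : [set F : {set {set 'I_n}} | (F \subset E) && cycle_edges (2 * l).+1 F]
    \subset Phi @: Tr.
  apply/subsetP=> F; rewrite inE => /andP[FE /(cycle_edgesP _ (ltn0Sn _))].
  move=> [c [uc sc FEc]]; move: FE; rewrite FEc (cycle_edge_set_sub E uc) => cc.
  case: c uc sc cc {FEc} => // v c uc [sc] cc.
  pose p := take l c; pose q := rev (drop l c).
  have sp : size p = l by rewrite size_take sc; case: ifP => //; clear; lia.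
  have sq : size q = l by rewrite size_rev size_drop sc; clear; lia.
  have cE : c = p ++ rev q by rewrite revK cat_take_drop.
  have [x hx] : exists x, is_path_to (adj E) v l x p.
    exists (last v p); rewrite /is_path_to sp !eqxx andbT /=.
    move: uc cc; rewrite cE /= mem_cat negb_or cat_uniq rcons_cat cat_path.
    by move=> /andP[/andP[-> _] /andP[-> _]] /andP[-> _].
  have [y hy] : exists y, is_path_to (adj E) v l y q.
    exists (last v q); rewrite /is_path_to sq !eqxx andbT /=.
    move: uc cc; rewrite cE /= mem_cat negb_or cat_uniq mem_rev rev_uniq rcons_cat.
    move=> /andP[/andP[_ ->] /and3P[_ _ ->]].
    (* Reading the closed walk backwards shows that [q] is a path from [v]. *)
    have := rev_path (adj E) v (rcons (p ++ rev q) v).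
    rewrite last_rcons belast_rcons rev_cons (eq_path (e' := adj E)); last first.
      by move=> a b; apply: e_sym.
    by rewrite rev_cat revK !rcons_cat !cat_path => <- /andP[->].
  have hx' := path_toP (is_path_to_sphere hx).
  have hy' := path_toP (is_path_to_sphere hy).
  have ll : l + l <= 2 * l by rewrite mul2n addnn.
  apply/imsetP; exists (v, (x, y)).
    have xL : x \in L v := is_path_to_sphere hx.
    have yL : y \in L v := is_path_to_sphere hy.
    rewrite inE /= xL inE yL /=.
    have [q' qE] := is_path_to_last l0 hy.
    move: cc; rewrite cE /= rcons_cat cat_path qE rev_rcons /=.
    by case/and4P: hx => _ _ _ /eqP-> /andP[_ /andP[]].
  rewrite /Phi /P /= cE.
  rewrite (is_path_to_inj e_sym girth hx hx' ll).
  by rewrite (is_path_to_inj e_sym girth hy hy' ll).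
apply: leq_trans (subset_leq_card sub) (leq_trans (leq_imset_card _ _) _).
have -> : #|Tr| = \sum_v \sum_(x in L v) #|nbhd (adj E) (L v) x|.
  rewrite -sum1_card.
  under [RHS]eq_bigr => v _.
    under eq_bigr => x _ do rewrite -sum1_card.
    rewrite (pair_big_dep (mem (L v)) (fun x y => y \in nbhd (adj E) (L v) x)
      (fun _ _ => 1)) /=.
    over.
  rewrite (pair_big_dep predT (fun v t => (t.1 \in L v) &&
    (t.2 \in nbhd (adj E) (L v) t.1)) (fun _ _ => 1)) /=.
  by apply: eq_bigl => t; rewrite inE.
have le1 v : \sum_(x in L v) #|nbhd (adj E) (L v) x| <= 2 * (2 * k).+1 * n.
  apply: leq_trans (sphere_sparse v e_sym e_irr girth nolong l0 lk) _.
  by rewrite leq_mul2l -[X in _ <= X]card_ord max_card orbT.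
apply: (@leq_trans (\sum_(v < n) 2 * (2 * k).+1 * n)).
  by apply: leq_sum => v _; apply: le1.
by rewrite sum_nat_const card_ord mulnCA mulnn.
Qed.

(** * Balls and scattered sets of vertices *)

Section Balls.
Variables (T : finType) (e : rel T).
Hypothesis e_sym : symmetric e.

Fixpoint ball t x : {set T} :=
  if t is t'.+1 then \bigcup_(y in ball t' x) (y |: [set z | e y z]) else [set x].

Lemma ball_step t x y z : y \in ball t x -> e y z -> z \in ball t.+1 x.
Proof. by move=> yb eyz; apply/bigcupP; exists y; rewrite // !inE eyz orbT. Qed.

Lemma ball_leq a b x : a <= b -> ball a x \subset ball b x.
Proof.
move/subnK <-; elim: (b - a) => // m IH; apply: subset_trans IH _.
by apply/subsetP=> y yb; apply/bigcupP; exists y; rewrite ?inE ?eqxx.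
Qed.

Lemma ball_trans a b x y z :
  y \in ball a x -> z \in ball b y -> z \in ball (a + b) x.
Proof.
move=> yx; elim: b z => [|b IH] z; first by rewrite addn0 inE => /eqP->.
case/bigcupP=> w wy; rewrite addnS inE => hz; apply/bigcupP; exists w => //.
  exact: IH.
by rewrite inE.
Qed.

Lemma ball_sym t x y : y \in ball t x -> x \in ball t y.
Proof.
elim: t y => [|t IH] y; first by rewrite !inE eq_sym.
case/bigcupP=> z /IH xz hy; rewrite -add1n; apply: ball_trans xz.
apply/bigcupP; exists y; rewrite ?inE //; move: hy; rewrite !inE eq_sym.
by rewrite e_sym.
Qed.

Lemma card_ball D t x : (forall y, #|[set z | e y z]| <= D) ->
  #|ball t x| <= D.+1 ^ t.
Proof.
move=> hD; elim: t => [|t IH]; first by rewrite cards1.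
apply: (@leq_trans (\sum_(y in ball t x) D.+1)); last first.
  by rewrite sum_nat_const expnS mulnC leq_mul2l IH orbT.
rewrite /=; elim/big_rec2: _ => [|y m A _ hA]; first by rewrite cards0.
apply: leq_trans (leq_card_setU _ _) _; apply: leq_add => //.
by rewrite cardsU1 -[D.+1]add1n; apply: leq_add => //; case: (_ \in _).
Qed.

(** Greedy choice: the balls around fewer than [r] chosen vertices cover fewer than [r * B]
    vertices, so some vertex of [A] is outside all of them. *)
Lemma exists_scattered (A : {set T}) t B r m :
  0 < B -> (forall x, #|ball t x| <= B) -> r * B <= #|A| -> m <= r ->
  exists s, [/\ size s = m, uniq s, {subset s <= A} &
    {in s &, forall x y, y \in ball t x -> x = y}].
Proof.
move=> B0 hB hA; elim: m => [|m IH] mr; first by exists [::].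
have [s [ss us sA sf]] := IH (ltnW mr).
have : 0 < #|A :\: \bigcup_(x in s) ball t x|.
  rewrite cardsD subn_gt0; apply: leq_trans hA.
  apply: leq_ltn_trans (_ : m * B < _); last by rewrite ltn_mul2r B0.
  apply: leq_trans (subset_leq_card (subsetIr _ _)) _.
  apply: (@leq_trans (\sum_(x in s) B)).
    elim/big_rec2: _ => [|y b C _ hC]; first by rewrite cards0.
    by apply: leq_trans (leq_card_setU _ _) _; apply: leq_add.
  by rewrite sum_nat_const leq_mul2r -ss card_size orbT.
case/card_gt0P=> z; rewrite inE => /andP[zs zA].
have far x : x \in s -> z \notin ball t x.
  by move=> xs; apply: contraNN zs => zx; apply/bigcupP; exists x.
exists (z :: s); split; rewrite /= ?ss //.
- rewrite us andbT; apply/negP => /far /negP[].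
  exact: (subsetP (ball_leq z (leq0n t)) z (set11 z)).
- by move=> x; rewrite inE => /orP[/eqP->|/sA].
- move=> x y; rewrite !inE => /orP[/eqP->|xs] /orP[/eqP->|ys] //.
  + by move/ball_sym; rewrite (negbTE (far y ys)).
  + by rewrite (negbTE (far x xs)).
  exact: sf.
Qed.

End Balls.

(** * Short cycles after a cycle is attached along scattered vertices *)

Section AttachCycle.
Variables (T : finType) (e : rel T) (g : seq T) (t : nat).
Hypothesis ug : uniq g.
Hypothesis scattered : {in g &, forall x y, y \in ball e t x -> x = y}.

Definition consecutive : rel T :=
  fun x y => (x \in g) && (y == next g x) || (y \in g) && (x == next g y).

Lemma consecutiveW x y : consecutive x y -> x \in g /\ y \in g.
Proof. by case/orP=> /andP[h /eqP->]; rewrite mem_next. Qed.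

Let e' : rel T := fun x y => e x y || consecutive x y.

(* p is the rest of a walk from y whose steps so far are old, and remain so until
   it meets g again; ending at a vertex of g other than y, it must be long. *)
Lemma no_old_return u p y t0 :
  y \in g -> u \in ball e t0 y -> path e' u p -> (u \in g -> e u (head u p)) ->
  p != [::] -> last u p \in g -> y \notin p -> t < t0 + size p.
Proof.
move=> yg; elim: p u t0 => [|z p IH] u t0 //= ub /andP[uz pz] hu _ lg.
rewrite inE negb_or => /andP[yz yp]; rewrite ltnNge; apply/negP => szt.
have {uz hu}uz : e u z.
  by case/orP: uz => // /consecutiveW[ug' _]; apply: hu.
have zb := ball_step ub uz.
have zg : z \notin g.
  apply/negP=> zg; case/negP: yz; apply/eqP/(scattered yg zg).
  by apply: (subsetP (ball_leq _ _ _)) zb; move: szt; clear; lia.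
have pn : p != [::] by apply: contraNneq zg => p0; rewrite p0 in lg.
have hz : z \in g -> e z (head z p) by rewrite (negbTE zg).
have := IH z t0.+1 zb pz hz pn lg yp.
by rewrite ltnNge addSnnS szt.
Qed.

(** An old first step would force length above [t] by [no_old_return]. So the first step is new and
    ends in [g], where the argument repeats. *)
Lemma path_consecutive y q : path e' y q -> uniq (y :: q) -> y \in g ->
  last y q \in g -> size q <= t -> path consecutive y q.
Proof.
elim: q y => [|z q IH] y //= /andP[yz pz] /andP[yq uq] yg lg sq.
have [cyz|ncyz] := boolP (consecutive y z).
  by apply: IH => //; [case/consecutiveW: cyz | apply: ltnW].
have eyz : e y z by move: yz; rewrite /e' (negbTE ncyz) orbF.
have := @no_old_return y (z :: q) y 0 yg (set11 y).
by rewrite /= yz pz => /(_ isT (fun _ => eyz) isT lg yq); rewrite add0n ltnNge sq.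
Qed.

(** A cycle with a new edge is rotated to start with it; the rest is a path of length at most [t]
    between two vertices of [g], to which [path_consecutive] applies. *)
Lemma cycle_split c : uniq c -> cycle e' c -> 2 < size c -> size c <= t.+1 ->
  cycle e c \/ cycle consecutive c.
Proof.
move=> uc cc c2 ct.
have [/hasP[x xc cx]|] := boolP (has (fun x => consecutive x (next c x)) c); last first.
  move/hasPn => nc; left; apply: cycle_from_next => // x xc.
  by have := next_cycle cc xc; rewrite /e' (negbTE (nc x xc)) orbF.
right; case: (rot_to xc) => i s sE.
rewrite -(rot_cycle i) sE; rewrite -(next_rot i uc) sE in cx.
rewrite -(rot_uniq i) sE in uc; rewrite -(rot_cycle i) sE in cc.
rewrite -(size_rot i) sE in c2 ct.
case: s {sE} uc cc c2 ct cx => [|y s] //= uc /andP[_ pc] c2 ct.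
rewrite eqxx => cx; rewrite cx /=.
have [xg yg] := consecutiveW cx.
apply: path_consecutive => //; rewrite ?last_rcons ?size_rcons //.
move: uc; rewrite inE negb_or cons_uniq rcons_uniq mem_rcons inE negb_or eq_sym.
by move=> /andP[/andP[-> ->] /andP[-> ->]].
Qed.

(* A vertex of c has two distinct neighbours in c, so they are its two neighbours
   in g: the vertex set of c is closed under [next g]. *)
Lemma cycle_consecutive_size c : uniq c -> cycle consecutive c -> 2 < size c ->
  size c = size g.
Proof.
move=> uc cc c2; apply/eqP; rewrite eqn_leq; apply/andP; split.
  apply: uniq_leq_size => // x xc.
  by case/consecutiveW: (next_cycle cc xc).
have next2 x : x \in c -> next c (next c x) != x.
  move=> xc; case: (rot_to xc) => i s sE.
  rewrite -!(next_rot i uc) sE.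
  have := uc; rewrite -(rot_uniq i) sE; move: c2; rewrite -(size_rot i) sE.
  case: s {sE} => [|y [|z s]] //= _; rewrite !eqxx !inE !negb_or.
  by case/and4P=> /and3P[xy xz _] _ _ _; rewrite [y == x]eq_sym (negbTE xy) eq_sym.
have closed_next y : y \in c -> next g y \in c.
  move=> yc; pose x := prev c y.
  have xc : x \in c by rewrite mem_prev.
  have xy : next c x = y by rewrite /x next_prev.
  have := next_cycle cc yc; case/orP=> /andP[_ /eqP].
    by move=> <-; rewrite mem_next.
  move=> yE; have := next_cycle cc xc; rewrite xy; case/orP=> /andP[_ /eqP]; last first.
    by move=> <-.
  rewrite {1}yE => /(can_inj (prev_next ug)) zx.
  by have := next2 x xc; rewrite xy zx eqxx.
apply: uniq_leq_size => // x.
have [y yc] : exists y, y \in c.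
  by case: (c) c2 => // y c' _; exists y; apply: mem_head.
have yg : y \in g by case/consecutiveW: (next_cycle cc yc).
case: (rot_to yg) => i s sE.
rewrite -(mem_rot i) sE.
have : path (frel (next g)) y s.
  have := cycle_next ug; rewrite -(rot_cycle i) sE /= rcons_path.
  by case/andP.
move: yc; clear -closed_next; elim: s y => [|z s IH] w wc /=.
  by rewrite inE => _ /eqP->.
case/andP=> /eqP wz pz; rewrite inE => /orP[/eqP->//|].
by apply: IH => //; rewrite -wz closed_next.
Qed.

End AttachCycle.

(** * The edge-maximal construction with bounded degree *)

Section Construction.
Variables (n k l D : nat).
Hypotheses (l_gt0 : 0 < l) (lk : l < k).
Implicit Type E : {set {set 'I_n}}.

Definition degree E (x : 'I_n) := #|[set e in E | x \in e]|.

Definition admissible E :=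
  [&& simple_graph E, family_free l k E, [forall x, degree E x <= D]
    & [forall e in E, exists F : {set {set 'I_n}},
        [&& F \subset E, e \in F & cycle_edges (2 * l).+1 F]]].

Lemma card_adj E x : #|[set y | adj E x y]| <= degree E x.
Proof.
rewrite -(card_imset (f := fun y => [set x; y])); last first.
  by move=> y z /set2_eq[[]|[]] // -> ->.
apply: subset_leq_card; apply/subsetP=> e /imsetP[y]; rewrite inE => xy ->.
by rewrite inE set21 andbT.
Qed.

Lemma sum_degree E : simple_graph E -> \sum_x degree E x = 2 * #|E|.
Proof.
move=> /forall_inP sE; rewrite mulnC -sum_nat_const.
under eq_bigr => x _ do rewrite /degree -sum1_card.
under eq_bigr => x _ do (under eq_bigl => e do rewrite inE).
rewrite (exchange_big_dep (mem E)) /=; last by move=> ? ? _ /andP[].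
apply: eq_bigr => e eE; rewrite -(eqP (sE e eE)) -sum1_card.
by apply: eq_bigl => x; rewrite eE.
Qed.

(** The copies of C_(2l+1) cover all edges of an admissible graph, and each has at most 2l + 1
    edges. *)
Lemma card_edges_le E : admissible E -> #|E| <= (2 * l).+1 * num_cycles (2 * l).+1 E.
Proof.
case/and4P=> _ _ _ /forall_inP cE.
set X := [set F : {set {set 'I_n}} | (F \subset E) && cycle_edges (2 * l).+1 F].
have sub : E \subset cover X.
  apply/subsetP=> e /cE /existsP[F /and3P[FE eF cF]].
  by apply/bigcupP; exists F => //; rewrite inE FE.
apply: leq_trans (subset_leq_card sub) _.
apply: leq_trans (leq_card_cover X) _.
rewrite /num_cycles -/X mulnC -sum_nat_const; apply: leq_sum => F.
rewrite inE => /andP[_ /(cycle_edgesP _ (ltn0Sn _))[c [_ <- ->]]].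
by apply: leq_trans (leq_imset_card _ _) (card_size _).
Qed.

Lemma mem_cycle_edge_set (c : seq 'I_n) x y :
  ([set x; y] \in cycle_edge_set c) = consecutive c x y.
Proof.
apply/imsetP/orP=> [[u uc /set2_eq[[-> ->]|[-> ->]]]|[/andP[xc /eqP->]|/andP[yc /eqP->]]].
- by left; rewrite uc eqxx.
- by right; rewrite uc eqxx.
- by exists x.
- by exists y; rewrite // setUC.
Qed.

(** By [cycle_split], a cycle of length from 3 to 2k + 1 in the union is either old, hence allowed,
    or made of new edges. In the latter case its length is 2l + 1, which is not forbidden since l <
    k. *)
Lemma admissible_attach E (g : seq 'I_n) : admissible E -> uniq g ->
  size g = (2 * l).+1 ->
  {in g, forall x, degree E x + (2 * l).+1 <= D} ->
  {in g &, forall x y, y \in ball (adj E) (2 * k) x -> x = y} ->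
  exists2 E', admissible E' & #|E| < #|E'|.
Proof.
case/and4P=> sE fE /forallP dE /forall_inP cE ug sg dg scat.
pose N := cycle_edge_set g; exists (E :|: N).
  have adjE' : adj (E :|: N) =2 fun x y => adj E x y || consecutive g x y.
    by move=> x y; rewrite -mem_cycle_edge_set -in_setU.
  apply/and4P; split.
  - apply/forall_inP=> e; rewrite inE => /orP[/(forall_inP sE)//|].
    case/imsetP=> x xg ->; rewrite cards2.
    case: (rot_to xg) => i s gE; rewrite -(next_rot i ug) gE.
    move: ug sg; rewrite -(rot_uniq i) -(size_rot i) gE.
    case: s {gE} => [|y s] /=; first by move=> _ []; move: l_gt0; clear; lia.
    by rewrite eqxx inE negb_or => /andP[/andP[->]].
  - apply/family_freeP => c uc; rewrite (eq_cycle adjE') => cc sc.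
    apply/negP => fc.
    have c2 : 2 < size c.
      by case/orP: fc => [/andP[]//|/eqP->]; move: l_gt0 lk; clear; lia.
    case: (cycle_split scat uc cc c2 sc) => c'.
      by move/family_freeP: fE => /(_ c uc c' sc); rewrite fc.
    move: fc; rewrite (cycle_consecutive_size ug uc c' c2) sg /forbidden.
    by rewrite ltnn andbF /= eqSS eqn_mul2l /= => /eqP kl; move: lk; rewrite kl ltnn.
  - apply/forallP=> x.
    have [xg|xg] := boolP (x \in g).
      (* The rise of the degree is bounded crudely by the number of all new edges. *)
      apply: leq_trans (dg x xg); rewrite -sg.
      apply: (@leq_trans (degree E x + #|N|)).
        apply: leq_trans (leq_card_setU _ _); apply: subset_leq_card.
        by apply/subsetP=> e; rewrite !inE => /andP[/orP[->->|->]]; rewrite ?orbT.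
      rewrite leq_add2l; apply: leq_trans (leq_imset_card _ _) (card_size _).
    apply: leq_trans (dE x); apply: subset_leq_card; apply/subsetP=> e.
    rewrite !inE => /andP[/orP[->->//|]] /imsetP[y yg ->].
    by rewrite !inE => /orP[] /eqP xy; move: xg; rewrite xy ?mem_next yg.
  - apply/forall_inP=> e; rewrite inE => /orP[/cE|eN].
      move=> /existsP[F /and3P[FE eF cF]]; apply/existsP; exists F.
      by rewrite eF cF (subset_trans FE) ?subsetUl.
    apply/existsP; exists N; rewrite subsetUr eN /=.
    by apply/cycle_edgesP => //; exists g.
(* If the first edge of the new cycle were old, its ends would be at distance 1 <= 2k, against the
   scattering. *)
apply: proper_card; rewrite properE subsetUl /=; apply/negP => sub.
case: g ug sg scat @N sub {dg} => [|x [|y s]] ug; try by [].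
  by case; move: l_gt0; clear; lia.
move=> _ scat N sub.
have : adj E x y.
  apply: (subsetP sub); rewrite inE mem_cycle_edge_set /consecutive mem_head /=.
  by rewrite !eqxx orbT.
move=> xy; have : x = y.
  apply: scat; rewrite ?inE ?eqxx ?orbT //.
  have y1 : y \in ball (adj E) 1 x by apply: ball_step xy; rewrite inE.
  by apply: (subsetP (ball_leq _ _ _)) y1; move: lk; clear; lia.
by move: ug; rewrite /= inE => /andP[/norP[/eqP]].
Qed.

(** Put r = 2l + 1. In a largest admissible graph, fewer than r (D + 1)^(2k) <= n / 2 vertices have
    degree at most D - r. The others have degree at least D + 1 - r, so n (D + 1 - r) is at most
    four times the number of edges, and [card_edges_le] contributes the factor r. *)
Lemma ex_cycles_ge : 2 * (2 * l).+1 * D.+1 ^ (2 * k) <= n ->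
  n * (D.+1 - (2 * l).+1) <= 4 * (2 * l).+1 * ex_cycles l k n.
Proof.
set r := (2 * l).+1; set B := D.+1 ^ (2 * k) => hn.
have adm0 : admissible set0.
  apply/and4P; split.
  - by apply/forall_inP=> e; rewrite inE.
  - apply/family_freeP => c uc; rewrite -(cycle_edge_set_sub _ uc) subset0.
    case: c {uc} => // x c /eqP /setP /(_ [set x; next (x :: c) x]).
    by rewrite inE; case/imsetP; exists x => //; apply: mem_head.
  - by apply/forallP=> x; rewrite /degree setIdE set0I cards0.
  - by apply/forall_inP=> e; rewrite inE.
case: (arg_maxnP (fun E : {set {set 'I_n}} => #|E|) adm0) => E adE maxE.
have [sE fE /forallP dE _] := and4P adE.
pose low := [set x | degree E x + r <= D].
have lowB : #|low| < r * B.
  rewrite ltnNge; apply/negP => hlow.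
  have B0 : 0 < B by rewrite expn_gt0.
  have cb x : #|ball (adj E) (2 * k) x| <= B.
    by apply: card_ball => y; apply: leq_trans (card_adj _ _) (dE y).
  have [g [sg ug gl scat]] :=
    exists_scattered (adj_sym E) B0 cb hlow (leqnn r).
  have [E' adE' ltE] : exists2 E', admissible E' & #|E| < #|E'|.
    by apply: (admissible_attach adE ug sg) => // x /gl; rewrite inE.
  have leE : #|E'| <= #|E| := maxE _ adE'.
  by rewrite leqNgt ltE in leE.
have num : num_cycles r E <= ex_cycles l k n.
  by rewrite /ex_cycles; apply: leq_bigmax_cond; rewrite sE.
have edges : #|E| <= r * num_cycles r E by apply: card_edges_le.
have deg : #|~: low| * (D.+1 - r) <= 2 * #|E|.
  rewrite -sum_degree // -sum_nat_const.
  rewrite [X in _ <= X](bigID (mem (~: low))) /=; apply: leq_trans (leq_addr _ _).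
  apply: leq_sum => x; rewrite !inE -ltnNge => h; rewrite leq_subLR addnC.
  exact: h.
have := cardsC low; rewrite card_ord => cl.
have high : n <= 2 * #|~: low|.
  move: cl lowB hn; rewrite -mulnA; clear; lia.
have h1 : n * (D.+1 - r) <= 2 * #|~: low| * (D.+1 - r) by rewrite leq_mul2r high orbT.
have h2 : r * num_cycles r E <= r * ex_cycles l k n by rewrite leq_mul2l num orbT.
apply: leq_trans h1 _; rewrite -mulnA -[4]/(2 * 2) -!mulnA leq_mul2l /=.
by apply: leq_trans deg _; rewrite leq_mul2l (leq_trans edges h2) orbT.
Qed.

End Construction.

(** * Choice of the degree bound and passage to real exponents *)

Lemma exists_root_floor a m n : 0 < a -> 0 < m ->
  exists M, a * M ^ m <= n < a * M.+1 ^ m.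
Proof.
move=> a0 m0; have P0 : exists M, a * M ^ m <= n.
  by exists 0; rewrite exp0n // muln0.
(* This bound allows taking the largest [M], the integer part of (n / a)^(1/m). *)
have Pn M : a * M ^ m <= n -> M <= n.
  apply: leq_trans; apply: leq_trans (leq_pmull _ a0).
  by case: M => // M; rewrite -[X in X <= _]expn1 leq_pexp2l.
case: (ex_maxnP P0 Pn) => M hM maxM; exists M; rewrite hM ltnNge.
by apply/negP => /maxM; rewrite ltnn.
Qed.

(** [M] has order n^(1/2k); its lower bound is recorded only with the weaker exponent 2k + 2 that
    the theorem asks for. *)
Lemma ex_cycles_lower k l : 0 < l -> l < k ->
  exists N, forall n, N <= n -> exists M,
    [/\ 0 < n, n <= (2 * (2 * l).+1 * M) ^ (2 * k + 2)
      & n * M <= 8 * (2 * l).+1 * ex_cycles l k n].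
Proof.
move=> l0 lk; set r := (2 * l).+1.
have k2 : 0 < 2 * k by rewrite muln_gt0 /=; apply: leq_ltn_trans lk.
(* This threshold forces the integer root to exceed 2r. *)
exists (2 * r * (2 * r).+1 ^ (2 * k)) => n nN.
have n0 : 0 < n by apply: leq_trans nN; rewrite muln_gt0 expn_gt0.
have [M /andP[hM hM1]] := @exists_root_floor (2 * r) (2 * k) n isT k2.
have rM : 2 * r < M.
  rewrite ltnNge; apply/negP => Mr; move: hM1; rewrite ltnNge => /negP; apply.
  by apply: leq_trans nN; rewrite leq_mul2l leq_exp2r // ltnS Mr orbT.
(* The root is D + 1 and the witness D + 2 rounds it up, so as to bound n from above. Since D >= 2r,
   D + 2 <= 2 (D + 1 - r), which doubles the constant 4 to 8. *)
case: M hM hM1 rM => // D hD hD1 rD; exists D.+2; split=> //.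
  apply: leq_trans (ltnW hD1) _.
  apply: (@leq_trans ((2 * r * D.+2) ^ (2 * k))); last first.
    by rewrite leq_pexp2l ?muln_gt0 // leq_addr.
  by rewrite expnMn leq_mul2r -[X in X <= _]expn1 leq_pexp2l ?orbT.
have := ex_cycles_ge l0 lk hD; rewrite -/r => h.
apply: (@leq_trans (2 * (n * (D.+1 - r)))).
  by rewrite mulnCA leq_mul2l; apply/orP; right; move: rD; clear; lia.
by rewrite -[8]/(2 * 4) -!mulnA leq_mul2l /= !mulnA.
Qed.

Lemma ex_cycles_upper k l n : 0 < l -> l < k ->
  ex_cycles l k n <= 2 * (2 * k).+1 * (n * n).
Proof.
move=> l0 lk; apply/bigmax_leqP => E /andP[sE fE].
by rewrite mulnn; apply: num_cycles_le.
Qed.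

From Stdlib Require Import Reals Lra.
Open Scope R_scope.

Lemma INR_expn a b : INR (expn a b) = INR a ^ b.
Proof. by elim: b => //= b IH; rewrite expnS -multE mult_INR IH. Qed.

Lemma Rpower_root_le (n m b : nat) : (0 < n)%nat -> (0 < m)%nat ->
  (n <= expn b m)%nat -> Rpower (INR n) (1 / INR m) <= INR b.
Proof.
move=> n0 m0 nb.
have b0 : (0 < b)%nat.
  by case: b nb => //; rewrite exp0n // leqn0 => /eqP nE; rewrite nE in n0.
have INR0 j : (0 < j)%nat -> 0 < INR j by move=> /ltP/lt_INR.
have <- : Rpower (INR b ^ m) (1 / INR m) = INR b.
  rewrite -Rpower_pow; last exact: INR0.
  rewrite Rpower_mult /Rdiv Rmult_1_l Rinv_r ?Rpower_1 //; first exact: INR0.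
  by apply: not_0_INR => mE; rewrite mE in m0.
apply: Rle_Rpower_l.
  by rewrite /Rdiv Rmult_1_l; apply/Rlt_le/Rinv_0_lt_compat/INR0.
by split; [apply: INR0 | rewrite -INR_expn; apply/le_INR/leP].
Qed.

Theorem theorem14 (k l : nat) (Hl : (2 <= l)%nat) (Hlk : (l < k)%nat) :
  (exists c : R, 0 < c /\ exists N : nat, forall n : nat, (N <= n)%nat ->
     c * Rpower (INR n) (1 + 1 / INR (2 * k + 2)) <= INR (ex_cycles l k n))
  /\
  (exists C : R, 0 < C /\ exists N : nat, forall n : nat, (N <= n)%nat ->
     INR (ex_cycles l k n) <= C * (INR n) ^ 2).
Proof.
have l0 : (0 < l)%nat by apply: leq_trans Hl.
set r := (2 * l).+1%nat.
have r0 : 0 < INR r by apply: lt_0_INR; apply/ltP.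
split.
  (* The factor 16 r^2 is the product of 2r, from the root being at most 2r M, and 8r, from the
     bound on n M. *)
  exists (/ (16 * (INR r * INR r))); split; first by apply: Rinv_0_lt_compat; nra.
  have [N hN] := ex_cycles_lower l0 Hlk; exists N => n /hN[M [n0 nM nex]].
  have nR : 0 < INR n by apply: lt_0_INR; apply/ltP.
  have k0 : (0 < 2 * k + 2)%nat by rewrite addn2.
  have root := Rpower_root_le n0 k0 nM.
  have /le_INR := leP nex; rewrite -!multE !mult_INR in root *.
  rewrite -/r in root * => nex'; rewrite Rpower_plus Rpower_1 //.
  move: (Rpower _ _) root nex' => P.
  have -> : INR 2 = 2 by [].
  have -> : INR 8 = 8 by rewrite /=; lra.
  move=> root nex'; apply: (Rmult_le_reg_l (16 * (INR r * INR r))); first by nra.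
  rewrite -Rmult_assoc Rinv_r; last by nra.
  have := Rmult_le_compat_l _ _ _ (Rlt_le _ _ nR) root.
  have := Rmult_le_compat_l _ _ _ (Rlt_le _ _ r0) nex'.
  lra.
exists (INR (2 * (2 * k).+1)); split; first by apply: lt_0_INR; apply/ltP.
exists 0%nat => n _; have /leP/le_INR := ex_cycles_upper n l0 Hlk.
by rewrite -!multE !mult_INR /= Rmult_1_r.
Qed.
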